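(* If $E \subseteq \mathbb{R}^2$ is a union of subsets of lines each of which has Hausdorff dimension $1$, then $$\dim_{\mathrm P} L_1^{\mathrm H}(E) = \dim_{\mathrm P} E.$$ In particular, if $E \subseteq \mathbb{R}^2$ is a union of line segments and $\mathbf{L}(E)$ is its lineal extension, then $\dim_{\mathrm P} \mathbf{L}(E) = \dim_{\mathrm P} E$.
   Context: $\dim_{\mathrm H}$ and $\dim_{\mathrm P}$ denote Hausdorff and packing dimension, respectively. Sets are arbitrary (no measurability is assumed). $\mathcal{A}(n,1)$ is the set of all (affine) lines in $\mathbb{R}^n$. Line segments are nondegenerate. For $E \subseteq \mathbb{R}^n$ a union of subsets of lines with Hausdorff dimension $1$, the $1$-Hausdorff extension of $E$ is $$L_1^{\mathrm H}(E) := \bigcup \{ \ell \in \mathcal{A}(n,1) : \dim_{\mathrm H}(\ell \cap E) \geq 1 \}.$$ If $E \subseteq \mathbb{R}^n$ is a union of line segments, its lineal extension is $$\mathbf{L}(E) := \bigcup \{ \ell \in \mathcal{A}(n,1) : E \cap \ell \text{ contains a line segment} \}.$$ *)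

(* Defs.v *)
From HB Require Import structures.
From mathcomp Require Import all_boot all_order all_algebra.
From mathcomp Require Import all_classical all_reals all_analysis.

Set Implicit Arguments.
Unset Strict Implicit.
Unset Printing Implicit Defensive.

Import Order.TTheory GRing.Theory Num.Theory.
Import numFieldNormedType.Exports.

Local Open Scope classical_set_scope.
Local Open Scope ring_scope.

Section EuclideanSpace.
Variables (R : realType) (n : nat).
Implicit Types (x y : 'rV[R]_n) (A : set 'rV[R]_n).

(* The norm that the library puts on 'rV[R]_n is the sup norm, so the Euclidean
   distance is defined separately. *)
Definition edist x y : R := Num.sqrt (\sum_(i < n) (x 0 i - y 0 i) ^+ 2).

Definition eball x (r : R) : set 'rV[R]_n := [set y | edist x y <= r].

(* Adjoining 0 gives the empty set diameter 0 instead of -oo. *)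
Definition ediam A : \bar R :=
  ereal_sup (0%E |` [set d | exists x y, [/\ A x, A y & d = (edist x y)%:E]]).

End EuclideanSpace.

Section HausdorffDimension.
Variables (R : realType) (n : nat).
Implicit Types (s delta : R) (A : set 'rV[R]_n) (U : (set 'rV[R]_n)^nat).

Definition hausdorff_cover delta A U : Prop :=
  A `<=` \bigcup_i U i /\ forall i, (ediam (U i) <= delta%:E)%E.

Definition hausdorff_premeasure s delta A : \bar R :=
  ereal_inf [set (\sum_(0 <= i <oo) ediam (U i) `^ s)%E
            | U in hausdorff_cover delta A].

Definition hausdorff_measure s A : \bar R :=
  ereal_sup [set hausdorff_premeasure s delta A | delta in [set d : R | 0 < d]].

(* Exponents are restricted to s > 0: this does not change the infimum, and it
   avoids the convention 0 `^ 0 = 1 for the empty members of a cover. *)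
Definition hausdorff_dim A : \bar R :=
  ereal_inf [set s%:E | s in [set s : R | 0 < s /\ hausdorff_measure s A = 0%E]].

End HausdorffDimension.

Section PackingDimension.
Variables (R : realType) (n : nat).
Implicit Types (s delta : R) (A : set 'rV[R]_n).

(* A packing is a countable disjoint family of closed balls; the index set
   D : set nat may be finite, so finite packings are included. *)
Definition packing delta A (D : set nat) (c : nat -> 'rV[R]_n) (r : nat -> R) :
    Prop :=
  (forall i, D i -> A (c i) /\ 0 < r i <= delta) /\
  trivIset D (fun i => eball (c i) (r i)).

Definition packing_presum s delta A : \bar R :=
  ereal_sup [set v | exists D c r, packing delta A D c r /\
                     v = (\esum_(i in D) ((2 * r i) `^ s)%:E)%E].

Definition packing_premeasure s A : \bar R :=
  ereal_inf [set packing_presum s delta A | delta in [set d : R | 0 < d]].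

(* The premeasure is not countably subadditive, hence the second infimum. *)
Definition packing_measure s A : \bar R :=
  ereal_inf [set (\sum_(0 <= i <oo) packing_premeasure s (U i))%E
            | U in [set U : (set 'rV[R]_n)^nat | A `<=` \bigcup_i U i]].

Definition packing_dim A : \bar R :=
  ereal_inf [set s%:E | s in [set s : R | 0 < s /\ packing_measure s A = 0%E]].

End PackingDimension.

Section Lines.
Variables (R : realType) (n : nat).
Implicit Types (E S l : set 'rV[R]_n).

Definition is_line l : Prop :=
  exists p v : 'rV[R]_n, v != 0 /\ l = [set p + t *: v | t in [set: R]].

Definition is_segment S : Prop :=
  exists a b : 'rV[R]_n,
    a != b /\ S = [set (1 - t) *: a + t *: b | t in `[0, 1]%classic].

Definition union_of_dim1_subsets_of_lines E : Prop :=
  exists F : set (set 'rV[R]_n),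
    (forall A, F A ->
      (exists l, is_line l /\ A `<=` l) /\ hausdorff_dim A = 1%E) /\
    E = \bigcup_(A in F) A.

Definition union_of_segments E : Prop :=
  exists F : set (set 'rV[R]_n),
    (forall S, F S -> is_segment S) /\ E = \bigcup_(S in F) S.

Definition hausdorff_extension1 E : set 'rV[R]_n :=
  \bigcup_(l in [set l | is_line l /\ (1 <= hausdorff_dim (l `&` E))%E]) l.

Definition lineal_extension E : set 'rV[R]_n :=
  \bigcup_(l in [set l | is_line l /\
                         exists S, is_segment S /\ S `<=` E `&` l]) l.

End Lines.

(* Main.v *)
Require Import Defs.
From mathcomp Require Import all_boot all_order all_algebra.
From mathcomp Require Import all_classical all_reals all_analysis.
From mathcomp Require Import ring lra zify.
(* Repeated so that [edist] is the Euclidean distance and not the one of the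
   library. *)
Require Import Defs.

(** If [dim_P E < t], then [E] is covered by sets [U_k] meeting at most
    [C 2^(nt)] dyadic squares of side [2^-n] for large [n].  If [l] is a line
    with [dim_H (l & E) >= 1], then for some [k] the set [l & U_k] meets at least
    [2^(n(1-e))] of the [2^-n]-columns for all large [n].  Fix [k] and consider
    all such lines in a bounded strip, with one point on a line for each of the squares
    they meet.  Two [2^-n]-tubes through points [x] and [y] share at most about
    [1 / dist(y, tube of x)] squares, so Cordoba's [L^2] argument
    (Cauchy-Schwarz on the incidences between the points and the squares of
    [U_k], through the tube of each point) bounds the number of points by the
    number of squares of [U_k], up to a factor [2^(2ne)] and a logarithm.
    Hence the union of these lines has upper box dimension at most [t + 3e] in
    the strip, and countably many choices of [k], strip and starting scale
    exhaust the extension. *)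

Set Implicit Arguments.
Unset Strict Implicit.
Unset Printing Implicit Defensive.

Import Order.TTheory GRing.Theory Num.Theory.
Import numFieldNormedType.Exports.

Local Open Scope classical_set_scope.
Local Open Scope ring_scope.

(** * Incidences of dyadic tubes *)

(** Cauchy-Schwarz, by expanding the nonnegative sum of squared deviations of [d] from its mean
    [mu]. *)
Lemma sqr_sum_le (R : realFieldType) (T : Type) (s : seq T) (d : T -> R) :
  (\sum_(g <- s) d g) ^+ 2 <= (size s)%:R * \sum_(g <- s) d g ^+ 2.
Proof.
case: (posnP (size s)) => [/size0nil ->|s_gt0].
  by rewrite !big_nil expr0n mul0r.
have n_gt0 : 0 < (size s)%:R :> R by rewrite ltr0n.
set S := \sum_(g <- s) d g; set Q := \sum_(g <- s) d g ^+ 2.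
pose mu := S / (size s)%:R.
have : 0 <= \sum_(g <- s) (d g - mu) ^+ 2.
  by apply: sumr_ge0 => g _; apply: sqr_ge0.
have -> : \sum_(g <- s) (d g - mu) ^+ 2 = Q - 2 * mu * S + (size s)%:R * mu ^+ 2.
  have -> : (size s)%:R * mu ^+ 2 = \sum_(g <- s) mu ^+ 2.
    by rewrite big_const_seq count_predT iter_addr_0 mulr_natl.
  rewrite mulr_sumr -sumrB -big_split /=.
  by apply: eq_bigr => g _; ring.
have muS : S = mu * (size s)%:R by rewrite /mu divfK ?gt_eqF.
rewrite muS => H.
have : 0 <= (size s)%:R * (Q - 2 * mu * (mu * (size s)%:R) + (size s)%:R * mu ^+ 2).
  by apply: mulr_ge0 => //; apply: ltW.
nra.
Qed.

Lemma ler_sum_subseq (R : realFieldType) (T : eqType) (s t : seq T) (F : T -> R) :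
  uniq s -> {subset s <= t} -> (forall x, 0 <= F x) ->
  \sum_(x <- s) F x <= \sum_(x <- t) F x.
Proof.
move=> + + F0; elim: s t => [|x s IH] t /=.
  by move=> _ _; rewrite big_nil sumr_ge0.
move=> /andP[xs us] st.
have xt : x \in t by apply: st; rewrite inE eqxx.
rewrite (perm_big _ (perm_to_rem xt)) !big_cons lerD2l IH// => y ys.
have := st y; rewrite inE ys orbT => /(_ isT) yt.
have := perm_mem (perm_to_rem xt) y; rewrite yt inE.
by case: eqVneq => [yx|//]; rewrite -yx ys in xs.
Qed.

(** Subtracting the least element embeds [s] into the naturals up to [Num.truncn B]. *)
Lemma size_int_diam (R : realType) (s : seq int) (B : R) : 0 <= B -> uniq s ->
  (forall k l, k \in s -> l \in s -> `|k - l|%:~R <= B) -> (size s)%:R <= B + 1.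
Proof.
move=> B0 us sB; case: (posnP (size s)) => [->|s_gt0]; first lra.
pose t := sort <=%O s.
have ts : t =i s by move=> x; rewrite mem_sort.
pose k0 := head 0 t.
have k0t : k0 \in t by rewrite /k0 -nth0 mem_nth ?size_sort.
have k0min k : k \in t -> k0 <= k.
  have := sort_le_sorted s; rewrite -/t /k0.
  case: (t) => [//|x t'] /= /(order_path_min le_trans) /allP tx.
  by rewrite inE => /orP[/eqP->//|/tx].
pose f k := absz (k - k0).
have szle : (size (map f s) <= size (iota 0 (Num.truncn B).+1))%N.
  apply: uniq_leq_size.
    rewrite map_inj_in_uniq// => k l; rewrite -!ts => /k0min kk /k0min kl.
    move=> /(congr1 Posz); rewrite /f !gez0_abs ?subr_ge0//.
    by move/addIr.
  move=> _ /mapP[k ks ->]; rewrite mem_iota /= add0n ltnS.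
  rewrite truncn_ge_nat//.
  have := sB k k0 ks; rewrite -ts => /(_ k0t).
  by rewrite -abszE.
rewrite size_map size_iota in szle.
have : (size s)%:R <= (Num.truncn B).+1%:R :> R by rewrite ler_nat.
move/le_trans; apply; rewrite -addn1 natrD lerD2r.
by rewrite truncn_le.
Qed.

Definition harm (R : realType) (n : nat) : R := \sum_(j < n) j.+1%:R^-1.

(** Each new term is at most the increment of [ln], by ln(1 + x) <= x at x = -1/(n + 2). *)
Lemma harm_le_ln (R : realType) n : harm R n.+1 <= 1 + ln n.+1%:R.
Proof.
rewrite /harm; elim: n => [|n IH].
  by rewrite big_ord_recr big_ord0 /= add0r invr1 ln1 addr0.
rewrite big_ord_recr /=.
suff H : n.+2%:R^-1 <= ln n.+2%:R - ln n.+1%:R :> R.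
  by have := lerD IH H; rewrite -(addrA 1) (addrC (ln n.+1%:R)) subrK.
have n1 : 0 < n.+1%:R :> R by rewrite ltr0n.
have n2 : 0 < n.+2%:R :> R by rewrite ltr0n.
have -> : ln n.+2%:R - ln n.+1%:R = - ln (1 - n.+2%:R^-1) :> R.
  have -> : 1 - n.+2%:R^-1 = n.+1%:R / n.+2%:R :> R.
    have n2' : n.+2%:R != 0 :> R by rewrite gt_eqF.
    apply: (mulIf n2'); rewrite mulrBl mul1r mulVf// divfK//.
    by rewrite -natr1 addrK.
  by rewrite ln_div ?posrE// opprB.
have := @le_ln1Dx R (- n.+2%:R^-1); rewrite ltrN2.
have -> : n.+2%:R^-1 < 1 :> R by rewrite invf_lt1// ltr1n.
by move=> /(_ isT); rewrite lerNr.
Qed.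

Definition int_range (M : nat) : seq int :=
  [seq i%:Z - M%:Z | i <- iota 0 (M.*2.+1)].

Lemma mem_int_range M (k : int) : `|k| <= M%:Z -> k \in int_range M.
Proof.
move=> kM; apply/mapP; exists (absz (k + M%:Z)).
  rewrite mem_iota /= add0n ltnS -addnn -lez_nat gez0_abs; last by lia.
  by rewrite PoszD; lia.
by rewrite gez0_abs; lia.
Qed.

Lemma mem_int_rangeS M (k : int) : `|k| <= M%:Z + 1 -> k \in int_range M.+1.
Proof. by move=> kM; apply: mem_int_range; rewrite intS addrC. Qed.

Lemma size_int_range M : size (int_range M) = M.*2.+1.
Proof. by rewrite size_map size_iota. Qed.

(** Split at 0: the nonnegative [w] give [harm R M.+1], the negative ones the same sum without its
    first term 1. *)
Lemma sum_int_range_harm (R : realType) M :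
  \sum_(w <- int_range M) (`|w| + 1)%:~R^-1 <= 2 * harm R M.+1.
Proof.
rewrite big_map; have -> : M.*2.+1 = (M + M.+1)%N by rewrite -addnn; lia.
rewrite iotaD add0n big_cat /=.
have H2 : \sum_(j <- iota M M.+1) (`|j%:Z - M%:Z| + 1)%:~R^-1 = harm R M.+1.
  rewrite -{1}[M]addn0 iotaDl big_map -/(index_iota 0 M.+1).
  rewrite big_mkord; apply: eq_bigr => i _.
  by rewrite PoszD addrAC subrr add0r ger0_norm// pmulrn intS addrC.
rewrite H2 mulr2n mulrDl mul1r lerD2r.
have -> : iota 0 M = index_iota 0 M by rewrite /index_iota subn0.
rewrite big_mkord (reindex_inj rev_ord_inj) /= /harm big_ord_recl /= invr1.
rewrite ler_wpDl//; apply: ler_sum => i _.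
rewrite /bump /= add1n [leLHS](_ : _ = i.+2%:R^-1)//.
by congr (_^-1); rewrite pmulrn; congr (_%:~R); have := ltn_ord i; lia.
Qed.



(** Lengths are in units of the side of a square. Let [D] be the vertical distance from [(u, v)] to
    the first line and [T] the difference of the slopes. On [K] the lines differ by at most 4, so
    [T] times the diameter of [K] is at most 8; moving from [u] to a column of [K] gives D <= 6 + T
    (2W + 2). Hence a large [D] forces a large [T] and a short [K], of size O(W / (D + 1)). The
    integer [w] is a rounded, signed version of [D]. *)
Lemma common_columns (R : realType) (W : nat) (m1 b1 m2 b2 : R) (u v : int)
    (K : seq int) :
  (0 < W)%N -> `|m1| <= 1 -> `|m2| <= 1 -> `|u| <= W%:Z + 1 ->
  `|m2 * u%:~R + b2 - v%:~R| <= 2 -> uniq K ->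
  (forall k, k \in K -> `|k| <= W%:Z + 1 /\
     exists l : int, `|m1 * k%:~R + b1 - l%:~R| <= 2 /\
                     `|m2 * k%:~R + b2 - l%:~R| <= 2) ->
  let w : int := v - Num.floor (m1 * u%:~R + b1) in
  (size K)%:R * (`|w| + 1)%:~R <= 150 * W%:R :> R /\
  (K != [::] -> `|w| <= (15 * W)%N%:Z).
Proof.
move=> W0 m1le m2le ule b2v uK HK w.
have W1 : 1 <= W%:R :> R by rewrite ler1n.
have [->|K0] := eqVneq K [::]; first by split => //; rewrite mul0r mulr_ge0.
pose D : R := `|v%:~R - m1 * u%:~R - b1|.
have D0 : 0 <= D by exact: normr_ge0.
pose T : R := `|m2 - m1|.
have T0 : 0 <= T by exact: normr_ge0.
have int_le (k : int) : `|k| <= W%:Z + 1 -> `|k%:~R| <= W%:R + 1 :> R.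
  by rewrite -(ler_int R) intr_norm rmorphD /= -pmulrn.
have uR := int_le _ ule.
have close k : k \in K -> `|(m2 - m1) * k%:~R + (b2 - b1)| <= 4.
  move=> /HK[_ [l []]]; rewrite !ler_norml => /andP[? ?] /andP[? ?].
  by apply/andP; split; lra.
have Dle : D <= 6 + T * (2 * W%:R + 2).
  have [k kK] : exists k, k \in K.
    by case: (K) K0 => // k K' _; exists k; rewrite inE eqxx.
  have := close k kK; have kR := int_le k (HK k kK).1.
  have -> : D = `|- (m2 * u%:~R + b2 - v%:~R) + (m2 - m1) * (u%:~R - k%:~R)
      + ((m2 - m1) * k%:~R + (b2 - b1))| by congr (`|_|); ring.
  move=> ck; apply: le_trans (ler_normD _ _) _.
  have := ler_normD (- (m2 * u%:~R + b2 - v%:~R)) ((m2 - m1) * (u%:~R - k%:~R)).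
  have : `|(m2 - m1) * (u%:~R - k%:~R)| <= T * (2 * W%:R + 2).
    rewrite normrM ler_wpM2l//; apply: le_trans (ler_normB _ _) _; lra.
  rewrite normrN; lra.
have Tle : T <= 2 by apply: le_trans (ler_normB _ _) _; lra.
have wD : (`|w| + 1)%:~R <= 2 * (D + 1) :> R.
  rewrite rmorphD /= intr_norm rmorphB /=.
  have := floor_itv (m1 * u%:~R + b1) => /andP[f1 f2].
  rewrite rmorphD /= in f2.
  have : `|v%:~R - (Num.floor (m1 * u%:~R + b1))%:~R| <= D + 1 :> R.
    have := lexx D; rewrite {1}/D !ler_norml => /andP[? ?].
    by apply/andP; split; lra.
  lra.
have Dle' : D <= 4 * W%:R + 10 by nra.
have D10 : 0 < D + 1 by lra.
(* The bound on [D] gives (D + 1)|k - l| <= 7|k - l| + 8(2W + 2), and |k - l| <= 2W + 2 turns this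
   into 30(W + 1). *)
have sK : (size K)%:R <= 30 * (W%:R + 1) / (D + 1) + 1.
  apply: size_int_diam => // [|k l kK lK].
    by rewrite divr_ge0 ?mulr_ge0 ?addr_ge0// ltW.
  rewrite ler_pdivlMr// intr_norm rmorphB /=.
  have kR := int_le k (HK k kK).1; have lR := int_le l (HK l lK).1.
  have kl : `|k%:~R - l%:~R| <= 2 * W%:R + 2 :> R.
    by apply: le_trans (ler_normB _ _) _; lra.
  have Tkl : T * `|k%:~R - l%:~R| <= 8.
    rewrite -normrM; have := close k kK; have := close l lK.
    rewrite !ler_norml => /andP[? ?] /andP[? ?].
    by apply/andP; split; lra.
  have := normr_ge0 (k%:~R - l%:~R : R).
  nra.
split.
  apply: (@le_trans _ _ ((30 * (W%:R + 1) / (D + 1) + 1) * (2 * (D + 1)))).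
    by apply: ler_pM => //; rewrite ler0z.
  rewrite mulrDl mulrCA -!mulrA mulVf ?gt_eqF//; lra.
move=> _; rewrite -(ler_int R) -pmulrn natrM.
rewrite rmorphD /= in wD.
have : `|w|%:~R <= D + 1 :> R.
  rewrite intr_norm rmorphB /=.
  have := floor_itv (m1 * u%:~R + b1) => /andP[f1 f2].
  rewrite rmorphD /= in f2.
  have := lexx D; rewrite {1}/D !ler_norml => /andP[? ?].
  by apply/andP; split; lra.
lra.
Qed.

(** Let [d g] count the [a] with [g] in [Y a]. The [d g] sum to at least [size A] times [m], and
    their squares sum to the number of common squares over all pairs [a], [b]. For fixed [a], a
    point [b] is determined by its column and its offset [w a b] from the tube of [a]; by
    [common_columns] the common squares number O(W / (|w a b| + 1)), so summing over O(W) columns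
    and all offsets yields the harmonic sum. *)
Lemma tube_incidence (R : realType) : exists2 C : R, 0 < C &
  forall (W : nat) (m : R) (A G : seq (int * int))
    (sl ic : int * int -> R) (Y : int * int -> seq (int * int)),
  (0 < W)%N -> 0 <= m -> uniq A ->
  (forall a, a \in A -> [/\ `|sl a| <= 1, `|a.1| <= W%:Z + 1,
     `|sl a * a.1%:~R + ic a - a.2%:~R| <= 2, m <= (size (Y a))%:R &
     uniq [seq g.1 | g <- Y a]]) ->
  (forall a g, a \in A -> g \in Y a -> [/\ g \in G, `|g.1| <= W%:Z + 1 &
     `|sl a * g.1%:~R + ic a - g.2%:~R| <= 2]) ->
  (size A)%:R * m ^+ 2 <= (size G)%:R * (C * W%:R ^+ 2 * harm R (15 * W).+1).
Proof.
have [c c1] : exists c : R, 150 <= c by exists 150.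
have c0 : 0 < c by lra.
exists (10 * c) => [|W m A G sl ic Y W0 m0 uA HA HY]; first by rewrite mulr_gt0.
have W1 : 1 <= W%:R :> R by rewrite ler1n.
pose inc a g : R := (g \in Y a)%:R.
pose S : R := 10 * c * W%:R ^+ 2 * harm R (15 * W).+1.
have S0 : 0 <= S.
  rewrite !mulr_ge0 ?(ltW c0) ?exprn_ge0//.
  by apply: sumr_ge0 => i _; rewrite invr_ge0.
rewrite -/S.
pose w a (b : int * int) : int := b.2 - Num.floor (sl a * b.1%:~R + ic a).
have pairle a b : a \in A -> b \in A ->
    \sum_(g <- Y a) inc b g <=
    if w a b \in int_range (15 * W) then c * W%:R * (`|w a b| + 1)%:~R^-1 else 0.
  move=> aA bA.
  have [sa a1 a2 ma ua] := HA a aA; have [sb b1 b2 mb ub] := HA b bA.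
  pose I := [seq g <- Y a | g \in Y b].
  (* The squares of [Y a] lie in distinct columns, so common squares may be counted by their
     columns. *)
  have -> : \sum_(g <- Y a) inc b g = (size [seq g.1 | g <- I])%:R.
    rewrite size_map size_filter -sum1_count natr_sum [RHS]big_mkcond /=.
    by apply: eq_bigr => g _; rewrite /inc; case: (_ \in _).
  have uI : uniq [seq g.1 | g <- I].
    by apply: subseq_uniq ua; apply: map_subseq; exact: filter_subseq.
  have [] := @common_columns R W (sl a) (ic a) (sl b) (ic b) b.1 b.2 _ W0
    sa sb b1 b2 uI.
    move=> k /mapP[g]; rewrite mem_filter => /andP[gb ga] ->.
    have [_ g1 g2] := HY a g aA ga; have [_ _ g3] := HY b g bA gb.
    by split => //; exists g.2.
  rewrite -/(w a b) => sI nI.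
  have [I0|/nI/mem_int_range ->] := eqVneq [seq g.1 | g <- I] [::].
    rewrite I0 /=; case: ifP => // _.
    by rewrite mulr_ge0 ?mulr_ge0 ?(ltW c0)// invr_ge0 ler0z.
  rewrite ler_pdivlMr ?ltr0z ?ltr_wpDl//.
  by apply: le_trans sI _; rewrite ler_wpM2r.
have rowle a : a \in A -> \sum_(b <- A) \sum_(g <- Y a) inc b g <= S.
  move=> aA.
  apply: (@le_trans _ _ (\sum_(b <- A | w a b \in int_range (15 * W))
      c * W%:R * (`|w a b| + 1)%:~R^-1)).
    rewrite [leRHS]big_mkcond big_seq [leRHS]big_seq.
    by apply: ler_sum => b bA; exact: pairle.
  pose F (p : int * int) : R := c * W%:R * (`|p.2| + 1)%:~R^-1.
  pose f (b : int * int) := (b.1, w a b).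
  rewrite -big_filter -(big_map f xpredT F).
  apply: (@le_trans _ _
    (\sum_(p <- allpairs pair (int_range W.+1) (int_range (15 * W))) F p)).
    apply: ler_sum_subseq.
    - rewrite map_inj_uniq ?filter_uniq// => -[x1 x2] [y1 y2] [] -> /=.
      by rewrite /w /=; move/addIr => ->.
    - move=> p /mapP[b]; rewrite mem_filter => /andP[wb bA] ->.
      apply/allpairsP; exists (f b); split => //=.
      have [_ b1 _ _ _] := HA b bA.
      exact: mem_int_rangeS.
    - by move=> p; rewrite mulr_ge0 ?mulr_ge0 ?(ltW c0)// invr_ge0 ler0z.
  rewrite big_allpairs.
  rewrite (_ : \sum_(u <- _) _ = W.+1.*2.+1%:R *
      (c * W%:R * \sum_(v <- int_range (15 * W)) (`|v| + 1)%:~R^-1)); last first.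
    under eq_bigr do rewrite /F /= -mulr_sumr.
    by rewrite big_const_seq count_predT iter_addr_0 size_int_range mulr_natl.
  have sW : W.+1.*2.+1%:R <= 5 * W%:R :> R.
    by rewrite -natrM ler_nat; lia.
  have hr := sum_int_range_harm R (15 * W).
  apply: (@le_trans _ _ (5 * W%:R * (c * W%:R * (2 * harm R (15 * W).+1)))).
    apply: ler_pM => //.
      rewrite mulr_ge0 ?mulr_ge0 ?(ltW c0)//.
      by apply: sumr_ge0 => i _; rewrite invr_ge0 ler0z.
    by rewrite ler_wpM2l// mulr_ge0// ltW.
  by rewrite /S le_eqVlt; apply/orP; left; apply/eqP; ring.
have degle a : a \in A -> m <= \sum_(g <- undup G) inc a g.
  move=> aA; have [_ _ _ mY uY] := HA a aA; apply: le_trans mY _.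
  rewrite -sum1_size natr_sum.
  have uYa := map_uniq uY.
  have -> : \sum_(i <- Y a) 1%:R = \sum_(g <- Y a) inc a g.
    by rewrite big_seq [RHS]big_seq; apply: eq_bigr => g gY; rewrite /inc gY.
  apply: ler_sum_subseq => // g gY.
  by rewrite mem_undup; have [] := HY a g aA gY.
pose d g := \sum_(a <- A) inc a g.
have sumd : (size A)%:R * m <= \sum_(g <- undup G) d g.
  rewrite exchange_big /= mulr_natl -iter_addr_0 -(count_predT A) -big_const_seq.
  by rewrite big_seq [leRHS]big_seq; apply: ler_sum.
have sumd2 : \sum_(g <- undup G) d g ^+ 2 <= (size A)%:R * S.
  have -> : \sum_(g <- undup G) d g ^+ 2 =
      \sum_(a <- A) \sum_(b <- A) \sum_(g <- undup G) inc a g * inc b g.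
    under eq_bigr do rewrite expr2 mulr_suml.
    rewrite exchange_big /=; apply: eq_bigr => a _.
    under eq_bigr do rewrite mulr_sumr.
    by rewrite exchange_big.
  rewrite mulr_natl -iter_addr_0 -(count_predT A) -big_const_seq.
  rewrite big_seq [leRHS]big_seq; apply: ler_sum => a aA.
  apply: le_trans (rowle a aA).
  apply: ler_sum => b _.
  have -> : \sum_(g <- undup G) inc a g * inc b g =
      \sum_(g <- [seq g <- undup G | g \in Y a]) inc b g.
    rewrite big_filter [RHS]big_mkcond; apply: eq_bigr => g _.
    by rewrite /inc; case: (g \in Y a); rewrite ?mul1r ?mul0r.
  apply: ler_sum_subseq => [|g|g]; last exact: ler0n.
  - by rewrite filter_uniq ?undup_uniq.
  - by rewrite mem_filter => /andP[].
have [/size0nil A0|A0] := posnP (size A).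
  by rewrite A0 mul0r mulr_ge0.
have A0' : 0 < (size A)%:R :> R by rewrite ltr0n.
rewrite -(ler_pM2l A0').
apply: (@le_trans _ _ (((size A)%:R * m) ^+ 2)).
  by rewrite exprMn (expr2 (size A)%:R) mulrA.
apply: (@le_trans _ _ ((\sum_(g <- undup G) d g) ^+ 2)).
  by rewrite ler_sqr ?nnegrE ?mulr_ge0// (le_trans _ sumd)// mulr_ge0.
apply: le_trans (sqr_sum_le _ _) _.
rewrite mulrCA; apply: ler_pM => //.
  by apply: sumr_ge0 => g _; exact: sqr_ge0.
by rewrite ler_nat size_undup.
Qed.

(** * Packing dimension and dyadic squares *)

Lemma geometric_le (R : realType) (q C e : R) : 0 <= q < 1 -> 0 <= C -> 0 < e ->
  exists N, forall n, (N <= n)%N -> C * q ^+ n <= e.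
Proof.
move=> /andP[q0 q1] C0 e0.
have C1 : 0 < C + 1 by rewrite ltr_wpDl.
have : (q ^+ n) @[n --> \oo] --> (0 : R) by apply: cvg_expr; rewrite ger0_norm.
move/cvgrPdist_le => /(_ (e / (C + 1)) (divr_gt0 e0 C1))[N _ HN].
exists N => n /HN; rewrite sub0r normrN ger0_norm ?exprn_ge0//.
rewrite ler_pdivlMr// => h; apply: le_trans h.
by rewrite mulrC ler_wpM2l ?exprn_ge0// lerDl.
Qed.

Lemma sum_geometric_le (R : realType) (q : R) N : 0 <= q < 1 ->
  \sum_(n < N) q ^+ n <= (1 - q)^-1.
Proof.
move=> /andP[q0 q1]; have q1' : 0 < 1 - q by rewrite subr_gt0.
rewrite -[leRHS]mul1r ler_pdivlMr// mulrC -opprB mulNr -subrX1 opprB.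
by rewrite lerBlDr lerDl exprn_ge0.
Qed.

Lemma abs_coord_le_edist (R : realType) n (x y : 'rV[R]_n) (i : 'I_n) :
  `|x 0 i - y 0 i| <= edist x y.
Proof.
rewrite -sqrtr_sqr ler_wsqrtr// (bigD1 i)//= lerDl.
by apply: sumr_ge0 => j _; exact: sqr_ge0.
Qed.

Lemma ord2_sum (V : nmodType) (i j : 'I_2) (F : 'I_2 -> V) : i != j ->
  \sum_k F k = F i + F j.
Proof.
rewrite !big_ord_recl big_ord0 addr0.
case: i => [[|[|//]] ilt]; case: j => [[|[|//]] jlt]//= _; last rewrite addrC.
  by congr (F _ + F _); exact: val_inj.
by congr (F _ + F _); exact: val_inj.
Qed.

Lemma edist_le2 (R : realType) (i j : 'I_2) (a : R) (x y : 'rV[R]_2) : i != j ->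
  `|x 0 i - y 0 i| <= a -> `|x 0 j - y 0 j| <= a -> edist x y <= 2 * a.
Proof.
move=> ij xi xj; have a0 : 0 <= a by apply: le_trans xi.
rewrite /edist (ord2_sum _ ij) -(ger0_norm (mulr_ge0 _ a0))// -sqrtr_sqr.
rewrite ler_wsqrtr//; move: xi xj; rewrite !ler_norml => /andP[? ?] /andP[? ?].
nra.
Qed.

Lemma edistxx (R : realType) n (x : 'rV[R]_n) : edist x x = 0.
Proof.
by rewrite /edist big1 ?sqrtr0// => i _; rewrite subrr expr0n.
Qed.

Definition dyadic (R : realType) (n : nat) (x : R) : int :=
  Num.floor (x * 2 ^+ n).

Lemma dyadic_itv (R : realType) n (x : R) :
  (dyadic n x)%:~R <= x * 2 ^+ n < (dyadic n x)%:~R + 1.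
Proof. by have := floor_itv (x * 2 ^+ n); rewrite rmorphD. Qed.

Lemma dyadic_near (R : realType) n (x y : R) : dyadic n x = dyadic n y ->
  `|x - y| <= 2 ^- n.
Proof.
move=> xy; have := dyadic_itv n x; have := dyadic_itv n y; rewrite xy.
have p0 : 0 < 2 ^+ n :> R by rewrite exprn_gt0.
move=> /andP[? ?] /andP[? ?].
rewrite -(ler_pM2r p0) mulVf ?gt_eqF// -[X in _ * X](ger0_norm (ltW p0)) -normrM.
by rewrite mulrBl ler_norml; apply/andP; split; lra.
Qed.

Lemma dyadic_far (R : realType) n (x y : R) : 2 <= `|dyadic n x - dyadic n y| ->
  2 ^- n < `|x - y|.
Proof.
have := dyadic_itv n x; have := dyadic_itv n y.
have p0 : 0 < 2 ^+ n :> R by rewrite exprn_gt0.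
move=> /andP[? ?] /andP[? ?] far.
rewrite -(ltr_pM2r p0) mulVf ?gt_eqF// -[X in _ * X](ger0_norm (ltW p0)) -normrM.
rewrite mulrBl.
have : 2 <= `|(dyadic n x)%:~R - (dyadic n y)%:~R| :> R.
  by rewrite -rmorphB /= -intr_norm -[2]/(2%:~R) ler_int.
rewrite ler_normr ltr_normr => /orP[?|?]; apply/orP; [left|right]; lra.
Qed.

(** The first index runs along coordinate [i], over which the lines under study are graphs of slope
    at most 1; the order of [i] and [j] thus treats flat and steep lines alike. *)
Definition cell (R : realType) (i j : 'I_2) n (x : 'rV[R]_2) : int * int :=
  (dyadic n (x 0 i), dyadic n (x 0 j)).

Definition meets_cell (R : realType) (i j : 'I_2) n (U : set 'rV[R]_2)
  (g : int * int) : Prop := exists2 x, U x & cell i j n x = g.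

(** Points chosen in such cells differ by more than 2^-n in some coordinate, so the balls of radius
    2^-n / 2 around them form a packing, each contributing (2^-n)^t. *)
Lemma separated_cells_le (R : realType) (t d M : R) (U : set 'rV[R]_2)
    (i j : 'I_2) n (G : seq (int * int)) :
  (packing_presum t d U <= M%:E)%E -> 2 ^- n <= d -> uniq G ->
  (forall g, g \in G -> meets_cell i j n U g) ->
  (forall g h, g \in G -> h \in G -> g != h ->
     2 <= `|g.1 - h.1| \/ 2 <= `|g.2 - h.2|) ->
  (size G)%:R <= M * (2 ^+ n) `^ t.
Proof.
move=> UM nd uG GU Gsep.
have p0 : 0 < 2 ^- n :> R by rewrite invr_gt0 exprn_gt0.
have /choice[c Hc] : forall k, exists x, (k < size G)%N ->
    U x /\ cell i j n x = nth (0, 0) G k.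
  move=> k; have [kG|] := ltnP k (size G); last by exists 0.
  by have [x Ux xk] := GU _ (mem_nth (0, 0) kG); exists x.
suff : ((size G)%:R * (2 ^- n) `^ t <= M).
  rewrite -(ler_pM2r (powR_gt0 t (exprn_gt0 n (ltr0n R 2)))) -mulrA.
  by rewrite -powRM// ?invr_ge0 ?exprn_ge0// mulVf ?gt_eqF ?exprn_gt0// powR1 mulr1.
rewrite -lee_fin; apply: le_trans UM; apply: ereal_sup_ubound.
exists `I_(size G), c, (fun=> 2 ^- n / 2); split.
  split=> [k kG|k l kG lG [y [yk yl]]].
    by split; [exact: (Hc k kG).1|lra].
  apply/eqP; apply: contraT => kl.
  have := Gsep _ _ (mem_nth (0, 0) kG) (mem_nth (0, 0) lG).
  rewrite nth_uniq// => /(_ kl).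
  have [_ <-] := Hc k kG; have [_ <-] := Hc l lG.
  rewrite /eball /= in yk yl.
  have close (a : 'I_2) : `|c k 0 a - c l 0 a| <= 2 ^- n.
    have := le_trans (abs_coord_le_edist (c k) y a) yk.
    have := le_trans (abs_coord_le_edist (c l) y a) yl.
    by rewrite !ler_norml => /andP[? ?] /andP[? ?]; apply/andP; split; lra.
  by move=> [] /dyadic_far; rewrite /= ltNge close.
rewrite esum_fset ?finite_II//.
rewrite -(@fsbig_ord _ _ _ _ (fun=> ((2 * (2 ^- n / 2)) `^ t)%:E)) sumEFin.
by congr EFin; rewrite sumr_const card_ord mulr_natl mulrC divfK.
Qed.

(** Cells are split into four classes by the parities of their indices; distinct cells of one class
    are separated as [separated_cells_le] requires. *)
Lemma cells_le_of_presum (R : realType) (t d M : R) (U : set 'rV[R]_2)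
    (i j : 'I_2) n (G : seq (int * int)) :
  (packing_presum t d U <= M%:E)%E -> 2 ^- n <= d -> uniq G ->
  (forall g, g \in G -> meets_cell i j n U g) ->
  (size G)%:R <= 4 * M * (2 ^+ n) `^ t.
Proof.
move=> UM nd uG GU.
pose par (g : int * int) := (odd `|g.1|%N, odd `|g.2|%N).
have parle p : (count (fun g => par g == p) G)%:R <= M * (2 ^+ n) `^ t.
  rewrite -size_filter; apply: (@separated_cells_le _ _ _ _ _ i j _ _ UM nd).
  - exact: filter_uniq.
  - by move=> g; rewrite mem_filter => /andP[_ /GU].
  - move=> [g1 g2] [h1 h2]; rewrite !mem_filter => /andP[/eqP <- _] /andP[/eqP + _].
    move=> [/= e1 e2]; rewrite xpair_eqE negb_and => /orP[ne|ne].
      left; lia.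
    right; lia.
have -> : size G = (count (fun g => par g == (true, true)) G +
  count (fun g => par g == (true, false)) G +
  count (fun g => par g == (false, true)) G +
  count (fun g => par g == (false, false)) G)%N.
  elim: (G) => //= g G' ->; case: (par g) => -[] [] /=; lia.
rewrite !natrD -mulrA; have := parle (true, true); have := parle (true, false).
have := parle (false, true); have := parle (false, false); lra.
Qed.

Lemma packing_premeasure_ge0 (R : realType) n (s : R) (U : set 'rV[R]_n) :
  (0 <= packing_premeasure s U)%E.
Proof.
apply: le_ereal_inf_tmp => _ [d _ <-]; apply: ereal_sup_ubound.
exists set0, (fun=> 0), (fun=> 0); split; last by rewrite esum_set0.
by split => // k l [].
Qed.

(** The lower bound on [r] lets the ball contain the whole dyadic cell of its centre, while the
    upper one bounds its contribution to a packing sum. The least [n] satisfying the lower bound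
    works. *)
Lemma dyadic_level (R : realType) (r : R) m : 0 < r <= 2 ^- m ->
  exists2 n, (m <= n)%N & 2 * 2 ^- n <= r < 4 * 2 ^- n.
Proof.
move=> /andP[r0 rm].
have half0 : 0 <= (2^-1 : R) < 1 by lra.
have [N HN] := geometric_le half0 (ltW (ltr0n R 2)) r0.
have ex : exists n, 2 * 2 ^- n <= r.
  by exists N; rewrite -exprVn; exact: HN.
case: (ex_minnP ex) => n nr nmin.
have mn : (m < n)%N.
  rewrite ltnNge; apply/negP => nm.
  have : 2 ^- m <= 2 ^- n :> R.
    by rewrite lef_pV2 ?posrE ?exprn_gt0// ler_eXn2l// ltr1n.
  have : 0 < 2 ^- n :> R by rewrite invr_gt0 exprn_gt0.
  lra.
exists n; first exact: ltnW.
rewrite nr /= ltNge; apply/negP => rn.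
case: n nr nmin mn rn => // n nr nmin _ rn.
suff /nmin : 2 * 2 ^- n <= r by rewrite ltnn.
apply: le_trans rn; rewrite exprS invfM.
have : 0 < 2 ^- n :> R by rewrite invr_gt0 exprn_gt0.
lra.
Qed.


Lemma powR2N_lt1 (R : realType) (a : R) : 0 < a -> 0 <= 2 `^ (- a) < 1.
Proof.
move=> a0; rewrite powR_ge0 powRN invf_lt1 ?powR_gt0//=.
have : (1 : R) `^ a < 2 `^ a by apply: gt0_ltr_powR; rewrite ?nnegrE ?ltr1n.
by rewrite powR1.
Qed.

Lemma powR2N_exp (R : realType) (a : R) n : (2 `^ (- a)) ^+ n = (2 ^- n) `^ a.
Proof.
have -> : 2 ^- n = 2 `^ (- n%:R) :> R by rewrite powR_invn.
rewrite -(powR_mulrn n (powR_ge0 2 (- a))) -!powRrM; congr (_ `^ _); ring.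
Qed.

(** The ball around [c k] contains the cell of [c k]; a centre [c l] in that cell would lie in both
    balls. *)
Lemma disjoint_balls_cell_inj (R : realType) (i j : 'I_2) n (D : set nat)
    (c : nat -> 'rV[R]_2) (r : nat -> R) k l :
  i != j -> trivIset D (fun k => eball (c k) (r k)) -> D k -> D l ->
  2 * 2 ^- n <= r k -> 0 < r l -> cell i j n (c k) = cell i j n (c l) -> k = l.
Proof.
move=> ij trD Dk Dl rk rl [ci cj]; apply: trD => //; exists (c l); split => /=.
  by rewrite /eball /=; apply: le_trans rk; apply: edist_le2 ij _ _;
    exact: dyadic_near.
by rewrite /eball /= edistxx ltW.
Qed.

(** Balls are grouped by dyadic level. Those of level [n] have centres in distinct cells, so there
    are at most K 2^(nt) of them, each contributing at most (8 * 2^-n)^(t + eta); the levels form a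
    geometric series of ratio 2^-eta. *)
Lemma packing_sum_le (R : realType) (i j : 'I_2) (V : set 'rV[R]_2)
    (K t eta : R) n0 m (D : set nat) (c : nat -> 'rV[R]_2) (r : nat -> R)
    (X : seq nat) :
  i != j -> 0 <= K -> 0 < t -> 0 < eta ->
  (forall n, (n0 <= n)%N -> forall G, uniq G ->
     (forall g, g \in G -> meets_cell i j n V g) ->
     (size G)%:R <= K * (2 ^+ n) `^ t) ->
  (n0 <= m)%N -> packing (2 ^- m) V D c r -> uniq X ->
  (forall k, k \in X -> D k) ->
  \sum_(k <- X) (2 * r k) `^ (t + eta) <= K * 8 `^ (t + eta) / (1 - 2 `^ (- eta)).
Proof.
move=> ij K0 t0 eta0 HV nm [HD trD] uX XD.
have q01 := powR2N_lt1 eta0; have /andP[q0 q1] := q01.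
have /choice[lv Hlv] : forall k, exists n, D k ->
    (m <= n)%N /\ 2 * 2 ^- n <= r k < 4 * 2 ^- n.
  move=> k; have [Dk|] := pselect (D k); last by exists 0%N.
  by have [n] := dyadic_level (HD k Dk).2; exists n.
pose N := (\max_(k <- X) lv k).+1.
have lvN k : k \in X -> (lv k < N)%N by move=> kX; rewrite ltnS leq_bigmax_seq.
have s0 : 0 <= t + eta by lra.
apply: (@le_trans _ _ (\sum_(n < N) \sum_(k <- X | lv k == n)
    8 `^ (t + eta) * (2 ^- n) `^ (t + eta))).
  rewrite (exchange_big_dep xpredT)//= big_seq [leRHS]big_seq.
  apply: ler_sum => k kX.
  rewrite (big_pred1 (Ordinal (lvN k kX))) => [|n]; last first.
    by apply/eqP/eqP => [e|->//]; exact/val_inj/esym.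
  have [_ /andP[rl ru]] := Hlv k (XD k kX).
  have p0 : 0 < 2 ^- lv k :> R by rewrite invr_gt0 exprn_gt0.
  rewrite -powRM ?(ltW p0)//=.
  by apply: ge0_ler_powR => //; rewrite ?nnegrE; lra.
apply: (@le_trans _ _ (\sum_(n < N) K * 8 `^ (t + eta) * (2 `^ (- eta)) ^+ n));
  last first.
  by rewrite -mulr_sumr ler_wpM2l ?sum_geometric_le// mulr_ge0 ?powR_ge0.
apply: ler_sum => n _.
rewrite big_const_seq iter_addr_0 -size_filter.
set Xn := [seq k <- X | lv k == n].
(* Levels below [n0] are empty: all radii are at most 2^-m with [n0 <= m], so all levels are at
   least [m]. *)
have [|Xn0] := leqP n0 n; last first.
  have -> : Xn = [::].
    rewrite -(filter_pred0 X); apply: eq_in_filter => k kX /=.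
    have [mk _] := Hlv k (XD k kX).
    by apply/negbTE/eqP => e; move: (leq_trans nm mk); rewrite e leqNgt Xn0.
  by rewrite mulr0n mulr_ge0 ?exprn_ge0// mulr_ge0 ?powR_ge0.
have XnX k : k \in Xn -> lv k = n /\ D k.
  by rewrite mem_filter => /andP[/eqP-> /XD].
have uXn : uniq [seq cell i j n (c k) | k <- Xn].
  rewrite map_inj_in_uniq ?filter_uniq// => k l /XnX[lk Dk] /XnX[ll Dl].
  apply: (disjoint_balls_cell_inj ij trD Dk Dl).
    by have [_ /andP[]] := Hlv k Dk; rewrite lk.
  by have [_ /andP[]] := HD l Dl.
move=> /HV /(_ _ uXn); rewrite size_map => sXn.
rewrite -[leLHS]mulr_natl mulrCA (mulrC K) -(mulrA (8 `^ _)) ler_wpM2l ?powR_ge0//.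
have p0 : 0 < 2 ^- n :> R by rewrite invr_gt0 exprn_gt0.
apply: le_trans (ler_wpM2r (powR_ge0 _ _) (sXn _)) _.
  by move=> _ /mapP[k /XnX[_ Dk] ->]; exists (c k) => //; have [] := HD k Dk.
rewrite -mulrA ler_wpM2l// powRD; last by rewrite (gt_eqF p0) implybT.
rewrite mulrA -powRM ?exprn_ge0 ?(ltW p0)// mulfV ?gt_eqF ?exprn_gt0// powR1 mul1r.
by rewrite powR2N_exp.
Qed.

(** Half of the gap [s - t] makes the geometric series over the levels converge; the other half
    leaves a factor (2 * 2^-m)^eta, which tends to 0 with the maximal radius. *)
Lemma packing_premeasure_eq0 (R : realType) (i j : 'I_2) (V : set 'rV[R]_2)
    (K t s : R) n0 :
  i != j -> 0 <= K -> 0 < t -> t < s ->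
  (forall n, (n0 <= n)%N -> forall G, uniq G ->
     (forall g, g \in G -> meets_cell i j n V g) ->
     (size G)%:R <= K * (2 ^+ n) `^ t) ->
  packing_premeasure s V = 0%E.
Proof.
move=> ij K0 t0 ts HV.
pose eta := (s - t) / 2.
have eta0 : 0 < eta by rewrite /eta; lra.
have es : s = t + eta + eta by rewrite /eta; field.
have q01 := powR2N_lt1 eta0; have /andP[q0 q1] := q01.
pose C := K * 8 `^ (t + eta) / (1 - 2 `^ (- eta)).
have C0 : 0 <= C by rewrite divr_ge0 ?subr_ge0 ?(ltW q1)// mulr_ge0 ?powR_ge0.
apply/eqP; rewrite eq_le packing_premeasure_ge0 andbT.
apply/lee_addgt0Pr => e e0; rewrite add0e.
have [N HN] := geometric_le q01 (mulr_ge0 (powR_ge0 2 eta) C0) e0.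
pose m := maxn N n0.
apply: ge_ereal_inf; exists (packing_presum s (2 ^- m) V).
  by exists (2 ^- m) => //=; rewrite invr_gt0 exprn_gt0.
apply: ge_ereal_sup => _ [D [c [r [pk ->]]]].
apply: ge_ereal_sup => _ [X [finX XD] <-].
rewrite fsbig_finite// sumEFin lee_fin.
have XsD k : k \in finmap.enum_fset (fset_set X) -> D k.
  by move=> kX; apply: XD; apply: set_mem; rewrite -in_fset_set.
have uX := finmap.fset_uniq (fset_set X).
set Xs : seq nat := finmap.enum_fset _ in XsD uX *.
apply: le_trans (HN m (leq_maxl _ _)).
have pm0 : 0 < 2 ^- m :> R by rewrite invr_gt0 exprn_gt0.
have -> : 2 `^ eta * C * 2 `^ (- eta) ^+ m = (2 * 2 ^- m) `^ eta * C.
  by rewrite powR2N_exp mulrAC -powRM// ltW.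
have pk' := pk; case: pk' => HD _.
apply: (@le_trans _ _ ((2 * 2 ^- m) `^ eta *
    \sum_(k <- Xs) (2 * r k) `^ (t + eta))).
  rewrite mulr_sumr big_seq [leRHS]big_seq; apply: ler_sum => k.
  move=> /XsD /HD[_ /andP[rk rm]].
  rewrite es powRD; last by rewrite implybE; apply/orP; right; lra.
  rewrite mulrC ler_wpM2r ?powR_ge0//.
  by apply: ge0_ler_powR; rewrite ?nnegrE; lra.
rewrite ler_wpM2l ?powR_ge0//.
exact: (packing_sum_le ij K0 t0 eta0 HV (leq_maxr N n0) pk uX XsD).
Qed.

Lemma packing_dim_le (R : realType) n (I : countType) (s : R)
    (A : set 'rV[R]_n) (V : I -> set 'rV[R]_n) :
  0 < s -> A `<=` \bigcup_i V i ->
  (forall i, packing_premeasure s (V i) = 0%E) -> (packing_dim A <= s%:E)%E.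
Proof.
move=> s0 AV V0; apply: ereal_inf_lbound; exists s => //; split => //.
apply/eqP; rewrite eq_le; apply/andP; split; last first.
  apply: le_ereal_inf_tmp => _ [U _ <-]; apply: nneseries_ge0 => k _ _.
  exact: packing_premeasure_ge0.
have set0P : packing_premeasure s (set0 : set 'rV[R]_n) = 0%E.
  apply/eqP; rewrite eq_le packing_premeasure_ge0 andbT.
  apply: ge_ereal_inf; exists (packing_presum s 1 (set0 : set 'rV[R]_n)).
    by exists 1 => /=.
  apply: ge_ereal_sup => _ [D [c [r [[HD _] ->]]]].
  rewrite esum1// => k Dk; by have [] := HD k Dk.
(* The family is enumerated by codes in [nat]; a code of no index gets the empty set, of premeasure
   0. *)
apply: ge_ereal_inf; exists (\sum_(0 <= k <oo) packing_premeasure s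
    (if unpickle k is Some i then V i else set0))%E; last first.
  by rewrite eseries0// => k _ _; case: unpickle.
exists (fun k => if unpickle k is Some i then V i else set0) => //= x /AV[i _ Vx].
by exists (pickle i) => //; rewrite pickleK.
Qed.

(** * Hausdorff dimension and dyadic columns *)

Lemma ediam_ge0 (R : realType) n (A : set 'rV[R]_n) : (0 <= ediam A)%E.
Proof. by apply: ereal_sup_ubound; left. Qed.

Lemma ediam_le (R : realType) n (A : set 'rV[R]_n) (d : R) : 0 <= d ->
  (forall x y, A x -> A y -> edist x y <= d) -> (ediam A <= d%:E)%E.
Proof.
by move=> d0 Ad; apply: ge_ereal_sup => _ [->|[x [y [Ax Ay ->]]]]; rewrite lee_fin// Ad.
Qed.

Lemma ediam0 (R : realType) n : ediam (set0 : set 'rV[R]_n) = 0%E.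
Proof. by apply/eqP; rewrite eq_le ediam_ge0 andbT; apply: ediam_le. Qed.

Lemma hausdorff_premeasure_ge0 (R : realType) n (s d : R) (A : set 'rV[R]_n) :
  (0 <= hausdorff_premeasure s d A)%E.
Proof.
apply: le_ereal_inf_tmp => _ [U _ <-].
by apply: nneseries_ge0 => k _ _; exact: poweR_ge0.
Qed.

(** Covers of the [V p] of cost at most e / 2^(p+1), all at the same scale [d], are merged through a
    bijection of [nat] with [nat * nat]. *)
Lemma hausdorff_premeasure_bigcup_eq0 (R : realType) n (s d : R)
    (A : set 'rV[R]_n) (V : nat -> set 'rV[R]_n) :
  A `<=` \bigcup_p V p -> (forall p, hausdorff_premeasure s d (V p) = 0%E) ->
  hausdorff_premeasure s d A = 0%E.
Proof.
move=> AV V0; apply/eqP; rewrite eq_le hausdorff_premeasure_ge0 andbT.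
apply/lee_addgt0Pr => e e0; rewrite add0e.
have /choice[U HU] : forall p, exists U, hausdorff_cover d (V p) U /\
    (\sum_(0 <= q <oo) ediam (U q) `^ s <= (e / (2 ^ p.+1)%:R)%:E)%E.
  move=> p; have : (hausdorff_premeasure s d (V p) < (e / (2 ^ p.+1)%:R)%:E)%E.
    by rewrite V0 lte_fin divr_gt0// ltr0n expn_gt0.
  by move=> /ereal_inf_lt[_ [U HU <-] /ltW ?]; exists U.
have /card_esym/ppcard_eqP[f] := card_nat2.
pose a (p q : nat) : \bar R := (ediam (U p q) `^ s)%E.
have a0 p q : (0 <= a p q)%E by exact: poweR_ge0.
apply: ge_ereal_inf; exists (\sum_(0 <= k <oo) a (f k).1 (f k).2)%E.
  exists (fun k => U (f k).1 (f k).2) => //; split=> [x /AV[p _ Vx]|k].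
    have [+ _] := (HU p).1; move=> /(_ x Vx)[q _ Ux].
    by exists (f^-1%FUN (p, q)) => //=; rewrite invK ?inE.
  by have [_] := (HU (f k).1).1; exact.
rewrite nneseries_esumT//.
rewrite -(@reindex_esum _ _ _ setT setT f (fun k => a k.1 k.2)); last first.
  exact: 'bij_f.
have -> : [set: nat * nat] = [set: nat] `*`` (fun=> [set: nat]).
  by apply/seteqP; split.
rewrite -esum_esum//.
apply: le_trans (epsilon_trick0 xpredT (ltW e0)).
rewrite nneseries_esumT; last by move=> k; rewrite lee_fin divr_ge0// ltW.
apply: le_esum => p _; rewrite -nneseries_esumT//.
by have [] := HU p.
Qed.

Lemma nneseries_le_partial (R : realType) (u : nat -> \bar R) (e : \bar R) :
  (forall k, (0 <= u k)%E) -> (forall n, (\sum_(0 <= k < n) u k <= e)%E) ->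
  (\sum_(0 <= k <oo) u k <= e)%E.
Proof.
move=> u0 ue; apply: (lime_le (is_cvg_nneseries (fun k _ _ => u0 k))).
by apply: nearW => n.
Qed.

Lemma hausdorff_premeasure_le_finite (R : realType) n (s d c : R) N
    (A : set 'rV[R]_n) (V : nat -> set 'rV[R]_n) :
  0 < s -> 0 <= c <= d -> A `<=` \bigcup_(k in `I_N) V k ->
  (forall k, (k < N)%N -> (ediam (V k) <= c%:E)%E) ->
  (hausdorff_premeasure s d A <= (N%:R * c `^ s)%:E)%E.
Proof.
move=> s0 /andP[c0 cd] AV Vc.
(* Padding by empty sets, which cost 0 because [0 < s]. *)
pose W k := if (k < N)%N then V k else set0.
have Wc k : (ediam (W k) <= c%:E)%E.
  by rewrite /W; case: ltnP => [/Vc//|_]; rewrite ediam0 lee_fin.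
apply: ge_ereal_inf; exists (\sum_(0 <= k <oo) ediam (W k) `^ s)%E.
  exists W => //; split=> [x /AV[k /= kN Vx]|k].
    by exists k => //; rewrite /W kN.
  by apply: le_trans (Wc k) _; rewrite lee_fin.
apply: nneseries_le_partial => [k|m]; first exact: poweR_ge0.
have W0 k : (N <= k)%N -> (ediam (W k) `^ s = 0)%E.
  by rewrite /W ltnNge => -> /=; rewrite ediam0 poweR0r// gt_eqF.
apply: (@le_trans _ _ (\sum_(0 <= k < N) (c `^ s)%:E)%E); last first.
  by rewrite sumEFin lee_fin sumr_const_nat subn0 mulr_natl.
apply: (@le_trans _ _ (\sum_(0 <= k < N) ediam (W k) `^ s)%E); last first.
  apply: lee_sum => k _; rewrite -poweR_EFin gt0_ler_poweR ?(ltW s0)//.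
  - by rewrite in_itv /= ediam_ge0 leey.
  - by rewrite in_itv /= lee_fin c0 leey.
have [mN|/ltnW Nm] := leqP m N.
  rewrite (big_cat_nat (leq0n m) mN)//= leeDl//.
  by apply: sume_ge0 => k _; exact: poweR_ge0.
rewrite (big_cat_nat (leq0n N) Nm)/= [X in (_ + X <= _)%E]big_nat_cond.
rewrite [X in (_ + X <= _)%E]big1 ?adde0// => k /andP[/andP[/W0]].
by [].
Qed.

Lemma hausdorff_dim_mono (R : realType) n (A B : set 'rV[R]_n) : A `<=` B ->
  (hausdorff_dim A <= hausdorff_dim B)%E.
Proof.
move=> AB; apply: le_ereal_inf_tmp => _ [s [s0 Bs] <-].
apply: ereal_inf_lbound; exists s => //; split => //.
apply/eqP; rewrite eq_le; apply/andP; split; last first.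
  apply: le_trans (hausdorff_premeasure_ge0 s 1 A) _.
  by apply: ereal_sup_ubound; exists 1 => //=.
rewrite -Bs; apply: ge_ereal_sup => _ [d d0 <-].
apply: (@le_trans _ _ (hausdorff_premeasure s d B)); last first.
  by apply: ereal_sup_ubound; exists d.
apply: ereal_inf_le_tmp => _ [U [BU Ud] <-]; exists U => //; split => //.
exact: subset_trans BU.
Qed.

Lemma packing_dim_mono (R : realType) n (A B : set 'rV[R]_n) : A `<=` B ->
  (packing_dim A <= packing_dim B)%E.
Proof.
move=> AB; apply: le_ereal_inf_tmp => _ [s [s0 Bs] <-].
apply: ereal_inf_lbound; exists s => //; split => //.
apply/eqP; rewrite eq_le; apply/andP; split; last first.
  apply: le_ereal_inf_tmp => _ [U _ <-]; apply: nneseries_ge0 => k _ _.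
  exact: packing_premeasure_ge0.
rewrite -Bs; apply: ereal_inf_le_tmp => _ [U BU <-]; exists U => //.
exact: subset_trans BU.
Qed.

Lemma hausdorff_dim_le (R : realType) n (s : R) (A : set 'rV[R]_n) : 0 < s ->
  (forall d, 0 < d -> hausdorff_premeasure s d A = 0%E) ->
  (hausdorff_dim A <= s%:E)%E.
Proof.
move=> s0 A0; apply: ereal_inf_lbound; exists s => //; split => //.
apply/eqP; rewrite eq_le; apply/andP; split.
  by apply: ge_ereal_sup => _ [d d0 <-]; rewrite A0.
by apply: ereal_sup_ubound; exists 1 => //=; exact: A0.
Qed.


Lemma rev_ord2_neq (i : 'I_2) : i != rev_ord i.
Proof. by case: i => [[|[|//]] ?]. Qed.

(** [i] is a coordinate in which the direction vector is largest in absolute value. *)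
Lemma line_sub_graph (R : realType) (l : set 'rV[R]_2) : is_line l ->
  exists i (m b : R), `|m| <= 1 /\
    forall x, l x -> x 0 (rev_ord i) = m * x 0 i + b.
Proof.
move=> [p [v [v0 ->]]].
have [i vi] : exists i : 'I_2, `|v 0 (rev_ord i)| <= `|v 0 i|.
  have [?|/ltW ?] := leP `|v 0 (rev_ord ord0)| `|v 0 ord0|; first by exists ord0.
  by exists (rev_ord ord0); rewrite rev_ordK.
have vi0 : v 0 i != 0.
  apply: contra v0 => /eqP vi0; apply/eqP/rowP => k; rewrite mxE.
  have vj0 : v 0 (rev_ord i) = 0.
    by apply/eqP; rewrite -normr_le0; apply: le_trans vi _; rewrite vi0 normr0.
  have [->//|ki] := eqVneq k i.
  suff -> : k = rev_ord i by [].
  apply: val_inj; move: ki; rewrite -val_eqE /=.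
  by case: (k) => [[|[|//]] ?]; case: (i) => [[|[|//]] ?].
exists i, (v 0 (rev_ord i) / v 0 i), (p 0 (rev_ord i) - v 0 (rev_ord i) / v 0 i * p 0 i).
split; first by rewrite normrM normfV ler_pdivrMr ?normr_gt0// mul1r.
by move=> _ [t _ <-]; rewrite !mxE; field.
Qed.

Lemma abs_dyadic_le (R : realType) n W (x : R) : `|x| <= W%:R ->
  `|dyadic n x| <= (W * 2 ^ n)%N%:Z + 1.
Proof.
have p0 : 0 < 2 ^+ n :> R by rewrite exprn_gt0.
have := dyadic_itv n x => /andP[? ?].
rewrite -(ler_pM2r p0) -[X in _ * X <= _](ger0_norm (ltW p0)) -normrM.
rewrite !ler_norml => /andP[? ?].
rewrite -!(ler_int R) rmorphN /= !intrD -!pmulrn !natrM !natrX.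
by apply/andP; split; lra.
Qed.

(** The width [W] and the starting scale [n0] are explicit parameters, so that the lines fall into
    countably many classes on which the count is uniform. *)
Definition column_rich (R : realType) (i : 'I_2) (U l : set 'rV[R]_2) (a : R)
    (W n0 : nat) : Prop :=
  forall n, (n0 <= n)%N -> exists K : seq int,
    [/\ uniq K, (2 ^+ n) `^ a <= (size K)%:R &
        forall k, k \in K -> exists2 x, [/\ l x, U x & `|x 0 i| <= W%:R] &
          dyadic n (x 0 i) = k].

(** Poverty yields arbitrarily fine scales at which fewer than 2^(na) columns are met. Since the
    slope is at most 1, the part of [l] in a column has diameter at most 2 * 2^-n, and the resulting
    cover costs at most 2^s 2^(-n(s - a)). *)
Lemma column_poor_premeasure (R : realType) (i : 'I_2) (U l : set 'rV[R]_2)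
    (m b a s d : R) (W : nat) :
  0 < s -> a < s -> 0 < d -> `|m| <= 1 ->
  (forall x, l x -> x 0 (rev_ord i) = m * x 0 i + b) ->
  (forall n0, ~ column_rich i U l a W n0) ->
  hausdorff_premeasure s d [set x | [/\ l x, U x & `|x 0 i| <= W%:R]] = 0%E.
Proof.
move=> s0 sa d0 m1 lgr poor; apply/eqP; rewrite eq_le hausdorff_premeasure_ge0 andbT.
apply/lee_addgt0Pr => e e0; rewrite add0e.
have sa0 : 0 < s - a by rewrite subr_gt0.
have [N1 HN1] := geometric_le (powR2N_lt1 sa0) (powR_ge0 2 s) e0.
have half : 0 <= (2^-1 : R) < 1 by lra.
have [N2 HN2] := geometric_le half (ltW (ltr0n R 2)) d0.
(* Past [N1] the cover costs at most [e]; past [N2] its pieces have diameter at most [d]. *)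
have /existsNP[n /not_implyP[nN /forallNP nK]] := poor (maxn N1 N2).
set A := [set x | _].
pose hit (k : int) := `[< exists2 x, A x & dyadic n (x 0 i) = k >].
pose K := [seq k <- undup (int_range (W * 2 ^ n).+1) | hit k].
have uK : uniq K by rewrite filter_uniq ?undup_uniq.
have sK : (size K)%:R <= (2 ^+ n) `^ a :> R.
  rewrite leNgt; apply/negP => h; apply: (nK K); split => //; first exact: ltW.
  by move=> k; rewrite mem_filter => /andP[/asboolP].
have p0 : 0 < 2 ^- n :> R by rewrite invr_gt0 exprn_gt0.
have cd : (0 <= 2 * 2 ^- n :> R) && (2 * 2 ^- n <= d).
  rewrite mulr_ge0 ?(ltW p0)//= -exprVn; apply: HN2.
  exact: leq_trans (leq_maxr _ _) nN.
pose V q := [set x | A x /\ dyadic n (x 0 i) = nth 0 K q].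
apply: le_trans (@hausdorff_premeasure_le_finite _ _ s d _ (size K) A V s0 cd _ _) _.
- move=> x Ax; exists (index (dyadic n (x 0 i)) K).
    rewrite /= index_mem mem_filter; apply/andP; split.
      by apply/asboolP; exists x.
    rewrite mem_undup; apply: mem_int_rangeS.
    by apply: abs_dyadic_le; case: Ax.
  split => //; rewrite nth_index// mem_filter; apply/andP; split.
    by apply/asboolP; exists x.
  rewrite mem_undup; apply: mem_int_rangeS.
  by apply: abs_dyadic_le; case: Ax.
- move=> q _; apply: ediam_le; first by case/andP: cd.
  move=> x y [[lx _ _] xq] [[ly _ _] yq].
  have xy : `|x 0 i - y 0 i| <= 2 ^- n by apply: dyadic_near; rewrite xq yq.
  apply: (edist_le2 (rev_ord2_neq i) xy).
  rewrite (lgr x lx) (lgr y ly).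
  rewrite (_ : _ - _ = m * (x 0 i - y 0 i)); last by ring.
  by rewrite normrM; apply: le_trans xy; apply: ler_piMl.
rewrite lee_fin; apply: le_trans (HN1 n (leq_trans (leq_maxl _ _) nN)).
rewrite powR2N_exp powRM ?(ltW p0)// mulrCA ler_wpM2l ?powR_ge0//.
apply: le_trans (ler_wpM2r (powR_ge0 _ _) sK) _.
rewrite powRB; last by rewrite (gt_eqF p0) implybT.
rewrite mulrC ler_wpM2l ?powR_ge0// -powRN.
have -> : 2 ^- n = 2 `^ (- n%:R) :> R by rewrite powR_invn.
by rewrite -(powR_mulrn n (ler0n R 2)) -!powRrM mulrNN.
Qed.

(** Otherwise [l] meets every [U k], within every strip, in a set of zero premeasure for the
    exponent (1 + a) / 2, and the countable union would give [l] and [E] an intersection of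
    dimension below 1. *)
Lemma exists_column_rich (R : realType) (i : 'I_2) (E l : set 'rV[R]_2)
    (U : nat -> set 'rV[R]_2) (m b a : R) :
  0 < a < 1 -> `|m| <= 1 ->
  (forall x, l x -> x 0 (rev_ord i) = m * x 0 i + b) ->
  E `<=` \bigcup_k U k -> (1 <= hausdorff_dim (l `&` E))%E ->
  exists k W n0, column_rich i (U k) l a W n0.
Proof.
move=> /andP[a0 a1] m1 lgr EU dim1; apply: contrapT => poor.
pose s := (1 + a) / 2.
have s0 : 0 < s by rewrite /s; lra.
have : (1 <= s%:E)%E.
  apply: le_trans dim1 _; apply: hausdorff_dim_le => // d d0.
  apply: (@hausdorff_premeasure_bigcup_eq0 _ _ _ _ _ (fun k => l `&` U k)).
    by move=> x [lx /EU[k _ Ux]]; exists k.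
  move=> k; apply: (@hausdorff_premeasure_bigcup_eq0 _ _ _ _ _
      (fun W => [set x | [/\ l x, U k x & `|x 0 i| <= W%:R]])).
    move=> x [lx Ux]; exists (Num.truncn `|x 0 i|).+1 => //; split => //.
    by apply: ltW; rewrite -truncn_lt_nat.
  move=> W; apply: (@column_poor_premeasure _ _ _ _ m b a) => //.
    by rewrite /s; lra.
  by move=> n0 h; apply: poor; exists k, W, n0.
by rewrite lee_fin /s; lra.
Qed.

(** The segment is projected to a coordinate in which its endpoints differ. For s < 1, a cover by
    sets of diameter at most 1 has diam <= diam^s, so a cheap cover would contradict the
    subadditivity of Lebesgue measure on the projection. *)
Lemma hausdorff_dim_segment_ge1 (R : realType) n (S A : set 'rV[R]_n) :
  is_segment S -> S `<=` A -> (1 <= hausdorff_dim A)%E.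
Proof.
move=> [p [q [pq SE]]] SA.
apply: le_ereal_inf_tmp => _ [s [s0 As] <-].
rewrite lee_fin leNgt; apply/negP => s1.
have [i pqi] : exists i, p 0 i != q 0 i.
  apply: contrapT => /forallNP h; move/eqP: pq; apply; apply/rowP => i.
  by have /negP/negPn/eqP := h i.
pose lo := Num.min (p 0 i) (q 0 i); pose hi := Num.max (p 0 i) (q 0 i).
have lohi : lo < hi.
  by rewrite /lo /hi; case: (ltgtP (p 0 i) (q 0 i)) pqi => // ->; rewrite eqxx.
(* Half the length, because a set of diameter [D k] projects into an interval [I k] of length twice
   [D k]. *)
pose c := (hi - lo) / 2.
have c0 : 0 < c by rewrite /c; lra.
have : (hausdorff_premeasure s 1 A < c%:E)%E.
  apply: (@le_lt_trans _ _ 0%E); last by rewrite lte_fin.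
  by rewrite -As; apply: ereal_sup_ubound; exists 1 => //=.
move=> /ereal_inf_lt[_ [U [AU U1] <-] sumU].
have Ufin k : ediam (U k) \is a fin_num.
  by rewrite ge0_fin_numE ?ediam_ge0//; apply: le_lt_trans (U1 k) _; rewrite ltry.
pose D k := fine (ediam (U k)).
have D0 k : 0 <= D k by rewrite fine_ge0 ?ediam_ge0.
have D1 k : D k <= 1 by rewrite -lee_fin fineK.
have /choice[x Hx] : forall k, exists x : R, forall y, (S `&` U k) y ->
    `|x - y 0 i| <= D k.
  move=> k; have [[z [Sz Uz]]|h] := pselect ((S `&` U k) !=set0); last first.
    by exists 0 => y Sy; case: h; exists y.
  exists (z 0 i) => y [_ Uy]; apply: le_trans (abs_coord_le_edist z y i) _.
  by rewrite -lee_fin fineK//; apply: ereal_sup_ubound; right; exists z, y.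
pose I k : set R := `[x k - D k, x k + D k]%classic.
have cover : `[lo, hi]%classic `<=` \bigcup_k I k.
  move=> y; rewrite /= in_itv /= => /andP[ylo yhi].
  have [t t01 yt] : exists2 t, t \in `[0, 1]%R & y = (1 - t) * p 0 i + t * q 0 i.
    exists ((y - p 0 i) / (q 0 i - p 0 i)).
      move: ylo yhi; rewrite /lo /hi in_itv /=.
      case: (ltgtP (p 0 i) (q 0 i)) pqi => // pq' _ y1 y2.
        by rewrite divr_ge0 ?ler_pdivrMr ?mul1r; lra.
      rewrite -mulrNN -invrN !opprB.
      by rewrite divr_ge0 ?ler_pdivrMr ?mul1r; lra.
    by field; rewrite subr_eq0 eq_sym.
  pose z := (1 - t) *: p + t *: q.
  have Sz : S z by rewrite SE; exists t.
  have [k _ Uz] := AU z (SA z Sz).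
  exists k => //; rewrite /I /= in_itv /=.
  have := Hx k z (conj Sz Uz); rewrite !mxE -yt ler_norml => /andP[? ?].
  by apply/andP; split; lra.
have mI k : measurable (I k) by exact: measurable_itv.
have mJ : measurable (`[lo, hi]%classic : set R) by exact: measurable_itv.
have : (lebesgue_measure (`[lo, hi]%classic : set R) <=
    \sum_(0 <= k <oo) lebesgue_measure (I k))%E.
  exact: measure_sigma_subadditive.
rewrite lebesgue_measure_itv /= lte_fin lohi -EFinD.
apply/negP; rewrite -ltNge.
apply: (@le_lt_trans _ _ (\sum_(0 <= k <oo) 2%:E * ediam (U k) `^ s)%E).
  apply: lee_nneseries => k // _.
  rewrite lebesgue_measure_itv /= lte_fin.
  have DDs : D k <= D k `^ s.
    have [->|Dk] := eqVneq (D k) 0; first by rewrite powR0// gt_eqF.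
    by apply: ger1_powR; rewrite ?(ltW s1)// lt_neqAle eq_sym Dk D0 D1.
  rewrite -(fineK (Ufin k)) -/(D k) poweR_EFin -EFinM.
  case: ifP => _; rewrite -?EFinB lee_fin; last by rewrite mulr_ge0 ?powR_ge0.
  lra.
rewrite nneseriesZl//; last by move=> k _; exact: poweR_ge0.
rewrite (_ : hi - lo = 2 * c); last by rewrite /c; field.
by rewrite EFinM lte_pmul2l// lte_fin.
Qed.

(** * Unions of lines *)

(** The logarithm is absorbed by a small power: e ln N = ln(N^e) <= N^e - 1. *)
Lemma harm_le_powR (R : realType) (e : R) : 0 < e ->
  exists2 K : R, 0 <= K & forall n, harm R n.+1 <= K * n.+1%:R `^ e.
Proof.
move=> e0; exists (1 + e^-1) => [|n]; first by rewrite addr_ge0// invr_ge0 ltW.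
have n1 : 1 <= n.+1%:R :> R by rewrite ler1n.
apply: le_trans (harm_le_ln R n) _; rewrite mulrDl mul1r lerD//.
  by rewrite -[leLHS](powRr0 n.+1%:R) ler_powR// ltW.
rewrite mulrC ler_pdivlMr// mulrC -ln_powR.
have p0 : 0 < n.+1%:R `^ e by rewrite powR_gt0// (lt_le_trans _ n1).
have := @le_ln1Dx R (n.+1%:R `^ e - 1).
rewrite ltrBrDr addrC subrr p0 => /(_ isT).
rewrite addrC subrK => /le_trans; apply; lra.
Qed.

(** Rounding [x] costs at most |m| <= 1 and rounding [y] at most 1; this is the tolerance 2 in
    [tube_incidence]. *)
Lemma dyadic_graph (R : realType) n (m b x y : R) : `|m| <= 1 ->
  y = m * x + b ->
  `|m * (dyadic n x)%:~R + b * 2 ^+ n - (dyadic n y)%:~R| <= 2.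
Proof.
move=> m1 yE.
have := dyadic_itv n x => /andP[x1 x2]; have := dyadic_itv n y => /andP[y1 y2].
have mx : `|m * (x * 2 ^+ n - (dyadic n x)%:~R)| <= 1.
  rewrite normrM -[leRHS]mulr1; apply: ler_pM => //.
  by rewrite ler_norml; apply/andP; split; lra.
have yn : y * 2 ^+ n = m * (x * 2 ^+ n) + b * 2 ^+ n by rewrite yE; ring.
move: mx; rewrite mulrBr !ler_norml => /andP[? ?].
by apply/andP; split; lra.
Qed.

Definition rich_points (R : realType) (i : 'I_2) (U : set 'rV[R]_2) (a : R)
    (W n0 : nat) : set 'rV[R]_2 :=
  [set x : 'rV[R]_2 | `|x 0 i| <= W%:R /\
     exists (l : set 'rV[R]_2) (m b : R), [/\ l x, `|m| <= 1,
       (forall y, l y -> y 0 (rev_ord i) = m * y 0 i + b) &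
       column_rich i U l a W n0]].

(** [tube_incidence] is applied with [A] the given cells, m = 2^(n(1 - e)) and [G] the cells of [U]
    met by the chosen lines. Of the loss 3e in the exponent, 2e comes from m^2 and e from the
    harmonic sum. *)
Lemma rich_points_cells (R : realType) (i : 'I_2) (U : set 'rV[R]_2)
    (t d e : R) (W n0 : nat) :
  0 < e -> (packing_presum t d U <= 1)%E ->
  exists2 K : R, 0 <= K & forall n, (n0 <= n)%N -> 2 ^- n <= d -> forall G, uniq G ->
    (forall g, g \in G ->
       meets_cell i (rev_ord i) n (rich_points i U (1 - e) W.+1 n0) g) ->
    (size G)%:R <= K * (2 ^+ n) `^ (t + 3 * e).
Proof.
move=> e0 Ud.
have [C C0 inc] := tube_incidence R.
have [H H0 Hharm] := harm_le_powR e0.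
(* 16 because (15 N) + 1 <= 16 N in the argument of [harm], with N = (W + 1) 2^n. *)
pose w : R := (16 * W.+1)%:R.
exists (4 * (C * W.+1%:R ^+ 2 * (H * w `^ e))).
  by rewrite !mulr_ge0 ?powR_ge0 ?exprn_ge0// ltW.
move=> n n0n nd A uA HA.
pose N := (W.+1 * 2 ^ n)%N.
(* [p] holds the slope and intercept of a line in units of 2^-n, and one cell of [U] along it for
   each of its rich columns. *)
pose good (a : int * int) (p : (R * R) * seq (int * int)) := [/\ `|p.1.1| <= 1,
  `|a.1| <= N%:Z + 1, `|p.1.1 * a.1%:~R + p.1.2 - a.2%:~R| <= 2,
  (2 ^+ n) `^ (1 - e) <= (size p.2)%:R & uniq [seq g.1 | g <- p.2] /\
  forall g, g \in p.2 -> [/\ meets_cell i (rev_ord i) n U g, `|g.1| <= N%:Z + 1 &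
    `|p.1.1 * g.1%:~R + p.1.2 - g.2%:~R| <= 2]].
have /choice[f Hf] : forall a, exists p, a \in A -> good a p.
  move=> a; have [aA|] := boolP (a \in A); last by exists (0, 0, [::]).
  have [x [xW [l [m [b [lx m1 lgr rich]]]]] xa] := HA a aA.
  have [K [uK sK HK]] := rich n n0n.
  have /choice[y Hy] : forall k, exists y, k \in K ->
      [/\ l y, U y & `|y 0 i| <= W.+1%:R] /\ dyadic n (y 0 i) = k.
    move=> k; have [kK|] := boolP (k \in K); last by exists 0.
    by have [y ? ?] := HK k kK; exists y.
  exists (m, b * 2 ^+ n, [seq (k, dyadic n (y k 0 (rev_ord i))) | k <- K]).
  move=> _; split => //=.
  - by rewrite -xa /=; exact: abs_dyadic_le.
  - by rewrite -xa /=; apply: dyadic_graph => //; exact: lgr.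
  - by rewrite size_map.
  - rewrite -map_comp (eq_map (g := id))// map_id; split => //.
    move=> _ /mapP[k kK ->] /=; have [[ly Uy yW] yk] := Hy k kK; split.
    + by exists (y k) => //; rewrite /cell yk.
    + by rewrite -yk; exact: abs_dyadic_le.
    + by rewrite -{1}yk; apply: dyadic_graph => //; exact: lgr.
pose G := undup (flatten [seq (f a).2 | a <- A]).
have sG : (size G)%:R <= 4 * 1 * (2 ^+ n) `^ t.
  apply: (@cells_le_of_presum _ _ _ _ _ i (rev_ord i) _ _ Ud nd).
    exact: undup_uniq.
  move=> g; rewrite mem_undup => /flatten_mapP[a aA gf].
  by have [_ _ _ _ [_ /(_ g gf)[]]] := Hf a aA.
have N0 : (0 < N)%N by rewrite muln_gt0 expn_gt0.
have p0 : 0 < 2 ^+ n :> R by rewrite exprn_gt0.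
set P : R := 2 ^+ n in nd sG p0 *.
have bound : (size A)%:R * (P `^ (1 - e)) ^+ 2 <=
    (size G)%:R * (C * N%:R ^+ 2 * harm R (15 * N).+1).
  apply: (inc N (P `^ (1 - e)) A G (fun a => (f a).1.1) (fun a => (f a).1.2)
    (fun a => (f a).2) N0 (powR_ge0 _ _) uA).
  - by move=> a /Hf[? ? ? ? []].
  - move=> a g aA gY; have [_ _ _ _ [_ Hg]] := Hf a aA.
    have [_ g1 g2] := Hg g gY; split => //.
    by rewrite mem_undup; apply/flatten_mapP; exists a.
have harmle : harm R (15 * N).+1 <= H * w `^ e * P `^ e.
  apply: le_trans (Hharm _) _; rewrite -mulrA ler_wpM2l// -powRM ?ler0n ?(ltW p0)//.
  apply: ge0_ler_powR; rewrite ?nnegrE ?(ltW e0)//.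
    by rewrite mulr_ge0 ?ler0n ?(ltW p0).
  by rewrite /w /P -natrX -natrM ler_nat /N; move: N0; rewrite /N; lia.
have Pa : (P `^ (1 - e)) ^+ 2 = P `^ (2 - 2 * e).
  by rewrite -powR_mulrn ?powR_ge0// -powRrM; congr (_ `^ _); ring.
rewrite Pa in bound.
rewrite -(ler_pM2r (powR_gt0 (2 - 2 * e) p0)).
apply: le_trans bound _.
(* The exponents balance: (t + 3e) + (2 - 2e) = t + 2 + e. *)
have -> : 4 * (C * W.+1%:R ^+ 2 * (H * w `^ e)) * P `^ (t + 3 * e) *
    P `^ (2 - 2 * e) = (4 * 1 * P `^ t) *
    (C * (W.+1%:R * P) ^+ 2 * (H * w `^ e * P `^ e)).
  have PD x y : P `^ (x + y) = P `^ x * P `^ y.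
    by rewrite powRD// (gt_eqF p0) implybT.
  have -> : (W.+1%:R * P) ^+ 2 = W.+1%:R ^+ 2 * P `^ 2 by rewrite exprMn powR_mulrn// ltW.
  rewrite -[RHS]mulrA.
  have -> : 4 * (C * W.+1%:R ^+ 2 * (H * w `^ e)) * P `^ (t + 3 * e) *
    P `^ (2 - 2 * e) = 4 * (C * W.+1%:R ^+ 2 * (H * w `^ e)) *
      (P `^ t * P `^ 2 * P `^ e).
    by rewrite -!PD -mulrA -PD; congr (_ * _ `^ _); ring.
  by move: (P `^ t) (P `^ 2) (P `^ e) (w `^ e) => *; ring.
have harm0 : 0 <= harm R (15 * N).+1.
  by apply: sumr_ge0 => k _; rewrite invr_ge0.
have -> : W.+1%:R * P = N%:R by rewrite /N natrM natrX.
apply: ler_pM => //.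
  by rewrite mulr_ge0// mulr_ge0 ?exprn_ge0// ltW.
by rewrite ler_wpM2l// mulr_ge0 ?exprn_ge0// ltW.
Qed.

(** An arbitrary family of such lines is allowed, so that both extensions are covered. *)
Lemma packing_dim_bigcup_lines (R : realType) (E : set 'rV[R]_2)
    (Ls : set (set 'rV[R]_2)) :
  (forall l, Ls l -> is_line l /\ (1 <= hausdorff_dim (l `&` E))%E) ->
  (packing_dim (\bigcup_(l in Ls) l) <= packing_dim E)%E.
Proof.
move=> HL; apply: le_ereal_inf_tmp => _ [t [t0 Et] <-].
apply/lee_addgt0Pr => eta eta0; rewrite -EFinD.
(* The first bound gives 3e < eta, the second keeps the richness exponent 1 - e positive. *)
pose e := Num.min (eta / 4) 2^-1.
have e0 : 0 < e by rewrite lt_min; apply/andP; split; lra.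
have e1 : e <= 2^-1 by rewrite ge_min lexx orbT.
have e4 : e <= eta / 4 by rewrite ge_min lexx.
have : (packing_measure t E < 1)%E by rewrite Et lte01.
move=> /ereal_inf_lt[_ [U EU <-] sumU].
have Ud k : exists2 d, 0 < d & (packing_presum t d (U k) <= 1)%E.
  have : (packing_premeasure t (U k) < 1)%E.
    apply: le_lt_trans sumU.
    apply: le_trans (nneseries_lim_ge k.+1 _) => [|j _ _].
      rewrite big_nat_recr//= leeDr// sume_ge0// => j _.
      exact: packing_premeasure_ge0.
    exact: packing_premeasure_ge0.
  by move=> /ereal_inf_lt[_ [d d0 <-] /ltW ?]; exists d.
pose V (p : 'I_2 * nat * nat * nat) :=
  rich_points p.1.1.1 (U p.1.1.2) (1 - e) p.1.2.+1 p.2.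
apply: (@packing_dim_le _ _ _ _ _ V) => [|x [l Ll lx]|[[[i k] W] n0]].
- lra.
- have [lline ldim] := HL l Ll.
  have [i [m [b [m1 lgr]]]] := line_sub_graph lline.
  have a01 : 0 < 1 - e < 1 by apply/andP; split; lra.
  have [k [W [n0 rich]]] := exists_column_rich a01 m1 lgr EU ldim.
  (* The strip must contain the point [x] as well as the rich columns of its line. *)
  pose W' := maxn W (Num.truncn `|x 0 i|).
  exists (i, k, W', n0) => //; split => /=.
    apply: (@le_trans _ _ (Num.truncn `|x 0 i|).+1%:R).
      by apply: ltW; rewrite -truncn_lt_nat.
    by rewrite ler_nat ltnS leq_maxr.
  exists l, m, b; split => // n nn; have [K [uK sK HK]] := rich n nn.
  exists K; split => // j /HK[y [ly Uy yW] yj]; exists y => //; split => //.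
  by apply: le_trans yW _; rewrite ler_nat leqW// leq_maxl.
- have [d d0 Ukd] := Ud k.
  have [K K0 HK] := @rich_points_cells _ i _ _ _ e W n0 e0 Ukd.
  have half : 0 <= (2^-1 : R) < 1 by lra.
  have [N HN] := geometric_le half ler01 d0.
  apply: (@packing_premeasure_eq0 _ i (rev_ord i) _ K (t + 3 * e) _ (maxn N n0)) => //.
  + exact: rev_ord2_neq.
  + lra.
  + lra.
  + move=> n nn; apply: HK.
      exact: leq_trans (leq_maxr _ _) nn.
    rewrite -exprVn -[leLHS]mul1r; apply: HN.
    exact: leq_trans (leq_maxl _ _) nn.
Qed.

Lemma segment_sub_line (R : realType) n (S : set 'rV[R]_n) : is_segment S ->
  exists2 l, is_line l & S `<=` l.
Proof.
move=> [p [q [pq ->]]]; exists [set p + t *: (q - p) | t in [set: R]].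
  by exists p, (q - p); rewrite subr_eq0 eq_sym.
move=> _ [t _ <-]; exists t => //.
by apply/rowP => k; rewrite !mxE; ring.
Qed.

Theorem theorem1p5 (R : realType) (E : set 'rV[R]_2) :
  (union_of_dim1_subsets_of_lines E ->
     packing_dim (hausdorff_extension1 E) = packing_dim E) /\
  (union_of_segments E ->
     packing_dim (lineal_extension E) = packing_dim E).
Proof.
split=> -[F [HF EF]]; apply/eqP; rewrite eq_le; apply/andP; split.
- by apply: packing_dim_bigcup_lines.
- apply: packing_dim_mono => x; rewrite {1}EF => -[A FA Ax].
  have [[l [lline Al]] dimA] := HF A FA.
  exists l; last exact: Al.
  split => //; rewrite -dimA; apply: hausdorff_dim_mono => y Ay.
  by split; [exact: Al|rewrite EF; exists A].
(* A line containing a segment of [E] meets [E] in dimension at least 1, so the same bound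
   applies. *)
- apply: packing_dim_bigcup_lines => l [lline [S [Sseg SEl]]]; split => //.
  by apply: hausdorff_dim_segment_ge1 Sseg _; rewrite setIC.
- apply: packing_dim_mono => x; rewrite {1}EF => -[S FS Sx].
  have [l lline Sl] := segment_sub_line (HF S FS).
  exists l; last exact: Sl.
  split => //; exists S; split; first exact: HF.
  by move=> y Sy; split; [rewrite EF; exists S|exact: Sl].
Qed.
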